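(* Let $Q=\mathbb{Z}_{q_1}\times\mathbb{Z}_{q_2}\times\cdots\times\mathbb{Z}_{q_n}$. There is no large set of mixed Steiner systems $\mathrm{MS}(t,k,Q)$, unless all the coordinates of $Q$ are over alphabets of the same size (that is, unless $q_1=q_2=\cdots=q_n$).
   Context: $Q=\mathbb{Z}_{q_1}\times\cdots\times\mathbb{Z}_{q_n}$ is viewed as the set of words of length $n$ whose $i$-th letter lies in $\mathbb{Z}_{q_i}$. The weight of a word is its number of nonzero coordinates, and $d(\cdot,\cdot)$ is the Hamming distance. A mixed Steiner system $\mathrm{MS}(t,k,Q)$ is a pair $(Q,\mathcal{C})$, where $\mathcal{C}$ is a set of words (codewords) of $Q$ of weight $k$ such that (i) for every word $x\in Q$ of weight $t$ there is exactly one codeword $c\in\mathcal{C}$ with $d(x,c)=k-t$; and (ii) the minimum Hamming distance of $\mathcal{C}$ is $2(k-t)+1$. A large set of $\mathrm{MS}(t,k,Q)$ is a partition of the set of all words of weight $k$ in $Q$ into mixed Steiner systems $\mathrm{MS}(t,k,Q)$. *)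

(* Defs.v *)
From mathcomp Require Import all_boot all_order all_algebra.

Set Implicit Arguments.
Unset Strict Implicit.
Unset Printing Implicit Defensive.

Import GRing.Theory.
Local Open Scope nat_scope.

(* Words of Z_(q_0) x ... x Z_(q_(n-1)).  The type 'Z_m is the ring of
   integers modulo m only when 1 < m. *)
Definition word (n : nat) (q : 'I_n -> nat) : finType :=
  {dffun forall i : 'I_n, 'Z_(q i)}.

Definition weight (n : nat) (q : 'I_n -> nat) (x : word q) : nat :=
  #|[set i : 'I_n | x i != 0%R]|.

Definition hamming (n : nat) (q : 'I_n -> nat) (x y : word q) : nat :=
  #|[set i : 'I_n | x i != y i]|.

(* The minimum is attained: a code with fewer than two words has no minimum
   distance. *)
Definition min_distance_is (n : nat) (q : 'I_n -> nat)
    (C : {set word q}) (d : nat) : Prop :=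
  (exists x y : word q,
     [/\ x \in C, y \in C, x != y & hamming x y = d]) /\
  (forall x y : word q,
     x \in C -> y \in C -> x != y -> d <= hamming x y).

(* MS(t,k,Q).  The subtraction k - t is truncated, so t <= k is expected. *)
Definition mixed_steiner_system (n : nat) (q : 'I_n -> nat) (t k : nat)
    (C : {set word q}) : Prop :=
  [/\ forall c : word q, c \in C -> weight c = k,
      forall x : word q, weight x = t ->
        exists! c : word q, c \in C /\ hamming x c = k - t
    & min_distance_is C (2 * (k - t) + 1)].

Definition large_set (n : nat) (q : 'I_n -> nat) (t k : nat)
    (P : {set {set word q}}) : Prop :=
  partition P [set x : word q | weight x == k] /\
  (forall C : {set word q}, C \in P -> mixed_steiner_system t k C).

(* Main.v *)
(** The words of weight [k] covering a fixed word [x] of weight [t] are in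
    bijection with the blocks of a large set: each block contains exactly one
    of them.  Hence their number does not depend on [x].  But if [q i < q j],
    replacing the coordinate [i] of the support of [x] by [j] makes
    strictly fewer words of weight [k] cover it, because the coordinate left
    free then has the smaller alphabet.  For [t = 0] a block has a single word,
    so it has no minimum distance. *)
Require Import Defs.
From mathcomp Require Import all_boot all_order all_algebra.
From mathcomp Require Import perm.

Set Implicit Arguments.
Unset Strict Implicit.
Unset Printing Implicit Defensive.

Import GRing.Theory.
Local Open Scope nat_scope.

Lemma subset_of_card (T : finType) (A : {set T}) (m : nat) :
  m <= #|A| -> exists2 B : {set T}, B \subset A & #|B| = m.
Proof.
rewrite cardE => le_m.
exists [set x in take m (enum A)].
  by apply/subsetP => x; rewrite inE => /mem_take; rewrite mem_enum.
by rewrite cardsE (card_uniqP _) ?take_uniq ?enum_uniq // size_takel.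
Qed.

Section Words.

Variables (n : nat) (q : 'I_n -> nat).
Implicit Types (x c : word q) (t k : nat).

Definition supp x : {set 'I_n} := [set i | x i != 0%R].

Definition ones (A : {set 'I_n}) : word q :=
  [ffun i => if i \in A then 1%R else 0%R].

Lemma supp_ones A : supp (ones A) = A.
Proof. by apply/setP => i; rewrite inE ffunE; case: ifP; rewrite ?oner_eq0 ?eqxx. Qed.

Lemma weight_ones A : weight (ones A) = #|A|.
Proof. by rewrite -[RHS](congr1 (fun B : {set _} => #|B|) (supp_ones A)). Qed.

Definition cover_words t k x : {set word q} :=
  [set c : word q | (weight c == k) && (hamming x c == k - t)].

(** [x] and [c] differ on all of [supp c :\: supp x], which has at least [k - t] elements. Distance
    exactly [k - t] therefore leaves no room for a difference inside [supp x]. *)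
Lemma hamming_weightP t k x c :
    t <= k -> weight x = t -> weight c = k ->
  reflect (forall i, x i != 0%R -> c i = x i) (hamming x c == k - t).
Proof.
move=> le_tk wx wc; set D := [set i | x i != c i].
have sD : supp c :\: supp x \subset D.
  by apply/subsetP => i; rewrite !inE negbK => /andP[/eqP -> ]; rewrite eq_sym.
apply: (iffP eqP) => [hD i xi | ext].
  have le_D : #|D| <= #|supp c :\: supp x|.
    rewrite -[#|D|]/(hamming x c) hD cardsD leq_sub //; first by rewrite -wc.
    by rewrite -wx subset_leq_card // subsetIr.
  have eD : supp c :\: supp x = D by apply/eqP; rewrite eqEcard sD.
  apply/eqP/negPn; rewrite eq_sym; apply/negP => ne.
  have : i \in D by rewrite inE.
  by rewrite -eD !inE xi.
have sub : supp x \subset supp c.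
  by apply/subsetP => i; rewrite !inE => xi; rewrite ext.
have -> : hamming x c = #|supp c :\: supp x|.
  apply: eq_card => i; rewrite !inE negbK.
  by have [->|/ext ->] := eqVneq (x i) 0%R; rewrite ?eqxx // eq_sym.
by rewrite cardsD (setIidPr sub) -wc -wx.
Qed.

Lemma mem_cover_ones k (A : {set 'I_n}) c : #|A| <= k ->
  (c \in cover_words #|A| k (ones A)) =
  (weight c == k) && [forall (i | i \in A), c i == 1%R].
Proof.
move=> le_Ak; rewrite inE; have [wc /=|//] := eqVneq.
apply/(hamming_weightP le_Ak (weight_ones A) wc)/forall_inP => h i.
  by move=> iA; have:= h i; rewrite ffunE iA oner_eq0 => ->.
by rewrite ffunE; case: ifP => [/h /eqP|]; rewrite ?eqxx.
Qed.

(** The bijection is [pblock P]: uniqueness of the codeword covering [x] makes it injective,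
    existence makes it surjective. *)
Lemma card_cover_words t k x (P : {set {set word q}}) :
  large_set t k P -> weight x = t -> #|cover_words t k x| = #|P|.
Proof.
move=> [/and3P[/eqP covP tiP _] sysP] wx.
have mem_cov c : c \in cover_words t k x -> c \in cover P.
  by rewrite covP !inE => /andP[].
rewrite -(_ : pblock P @: cover_words t k x = P) ?card_in_imset //.
- move=> c c' cA c'A eqb.
  have bP := pblock_mem (mem_cov _ cA).
  have [_ /(_ x wx)[d [_ dU]] _] := sysP _ bP.
  move: cA c'A (mem_cov _ cA) (mem_cov _ c'A); rewrite !inE.
  move=> /andP[_ /eqP hc] /andP[_ /eqP hc'] cc cc'.
  have <- : d = c by apply: dU; rewrite mem_pblock.
  by apply: dU; rewrite eqb mem_pblock.
apply/setP => B; apply/imsetP/idP => [[c /mem_cov cc ->]|BP].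
  exact: pblock_mem.
have [wB /(_ x wx)[c [[cB hc] _]] _] := sysP _ BP.
by exists c; rewrite ?inE ?wB ?hc ?eqxx // (def_pblock tiP BP cB).
Qed.

Lemma large_set_pos t k (P : {set {set word q}}) :
  k <= n -> large_set t k P -> 0 < t.
Proof.
rewrite lt0n => le_kn lsP; apply/eqP => t0; rewrite {t}t0 in lsP.
have [/and3P[/eqP covP _ _] sysP] := lsP.
(* Since [k <= n] there is a word of weight [k], hence a block; without one, the empty partition
   would be a large set vacuously. *)
move: le_kn; rewrite -{1}(card_ord n) -cardsT => /subset_of_card[K _ cK].
have : ones K \in cover P by rewrite covP inE weight_ones cK.
case/bigcupP => B BP _; have [wB covB [[x [y [xB yB nxy _]]] _]] := sysP B BP.
have w0 : weight (ones set0) = 0 by rewrite weight_ones cards0.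
have [d [_ dU]] := covB _ w0.
(* Every codeword covers the zero word, so uniqueness collapses the block to [d]. *)
have h0 c : c \in B -> d = c.
  move=> cB; apply: (dU); split=> //; apply/eqP.
  apply/(hamming_weightP _ w0 (wB _ cB)) => // i.
  by rewrite ffunE inE eqxx.
by case/eqP: nxy; rewrite -(h0 x) // -(h0 y).
Qed.

End Words.

Section Exchange.

Variables (n : nat) (q : 'I_n -> nat).
Hypothesis q_gt1 : forall i, 1 < q i.
Variables i j : 'I_n.
Hypothesis q_lt : q i < q j.

Let neq_ij : i != j.
Proof. by apply: contraTneq q_lt => ->; rewrite ltnn. Qed.

(** On words with letter 1 at [j], this swaps the coordinates [i] and [j]. The letter at [i] moves
    to the larger alphabet through its natural representative, which stays unreduced because
    [q i < q j]. *)
Definition exchange (c : word q) : word q :=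
  [ffun l => if l == i then 1%R else
             if l == j then (nat_of_ord (c i))%:R%R else c l].

Lemma exchange_val (c : word q) : exchange c j = c i :> nat.
Proof.
rewrite ffunE eq_sym (negbTE neq_ij) eqxx val_Zp_nat // modn_small //.
apply: leq_trans (ltnW q_lt).
by have := ltn_ord (c i); rewrite [X in _ < X -> _]Zp_cast.
Qed.

Lemma weight_exchange (c : word q) : c j = 1%R -> weight (exchange c) = weight c.
Proof.
move=> cj1; rewrite -[RHS](card_preimset (supp c) (@perm_inj _ (tperm i j))).
apply: eq_card => l; rewrite !inE.
case: tpermP => [->|->|/eqP/negbTE li /eqP/negbTE lj].
- by rewrite ffunE eqxx cj1 !oner_eq0.
- by rewrite -!val_eqE /= exchange_val.
- by rewrite ffunE li lj.
Qed.

(** [exchange] embeds the first set of words into the second. The set [K] only serves to build a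
    word outside the image. *)
Lemma card_cover_exchange (k : nat) (U K : {set 'I_n}) :
    U \subset K -> K \subset ~: [set i; j] -> #|K|.+2 = k ->
  #|cover_words #|j |: U| k (ones q (j |: U))| <
  #|cover_words #|i |: U| k (ones q (i |: U))|.
Proof.
move=> sUK sK cK.
have iK : i \notin K by apply/negP => /(subsetP sK); rewrite !inE eqxx.
have jK : j \notin K by apply/negP => /(subsetP sK); rewrite !inE eqxx orbT.
have iU : i \notin U by apply: contra iK => /(subsetP sUK).
have jU : j \notin U by apply: contra jK => /(subsetP sUK).
have leU : #|U| < k by rewrite -cK ltnS leqW // subset_leq_card.
have memA l c : l \notin U ->
  (c \in cover_words #|l |: U| k (ones q (l |: U))) =
  (weight c == k) && [forall (m | m \in l |: U), c m == 1%R].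
  by move=> lU; apply: mem_cover_ones; rewrite cardsU1 lU.
set A := cover_words _ _ (ones q (j |: U)).
have Aj c : c \in A -> c j = 1%R.
  by rewrite memA // => /andP[_ /forall_inP/(_ j)]; rewrite setU11 => /(_ isT)/eqP.
have inj : {in A &, injective exchange}.
  move=> c c' cA c'A eqc; apply/ffunP => l.
  have [->|nj] := eqVneq l j; first by rewrite !Aj.
  have [->|ni] := eqVneq l i.
    by apply: val_inj; rewrite /= -!exchange_val eqc.
  by move/ffunP/(_ l): eqc; rewrite !ffunE (negbTE ni) (negbTE nj).
rewrite -(card_in_imset inj); apply: proper_card; apply/properP; split.
  apply/subsetP => _ /imsetP[c cA ->]; move: (cA); rewrite !memA //.
  rewrite weight_exchange ?Aj // => /andP[-> /forall_inP ext] /=.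
  apply/forall_inP => l; rewrite ffunE !inE.
  have [//|_ /= lU] := eqVneq l i.
  by rewrite ifN ?ext ?inE ?lU ?orbT //; apply: contraNneq jU => <-.
(* The letter -1 at [j] has representative [q j - 1 >= q i], which no letter at [i] attains, so [z]
   is not an image; its support is [K] together with [i] and [j]. *)
pose z : word q :=
  [ffun l => if l == j then (- 1)%R else if l \in i |: K then 1%R else 0%R].
exists z.
  rewrite memA //; apply/andP; split.
    rewrite -cK (_ : weight z = #|j |: (i |: K)|).
      by rewrite !cardsU1 !inE negb_or [j == i]eq_sym neq_ij jK iK.
    apply: eq_card => l; rewrite [in LHS]inE ffunE !inE.
    have [->|_] := eqVneq l j; first by rewrite oppr_eq0 oner_eq0.
    by case: ifP; rewrite ?oner_eq0 ?eqxx.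
  apply/forall_inP => l lU; rewrite ffunE ifN.
    by rewrite (subsetP (setUS _ sUK)).
  by apply: contraTneq lU => ->; rewrite !inE negb_or [j == i]eq_sym neq_ij jU.
apply/negP => /imsetP[c _ /ffunP/(_ j)/(congr1 val) /=].
rewrite exchange_val ffunE eqxx => eqz.
have ci : c i < q i by have := ltn_ord (c i); rewrite [X in _ < X -> _]Zp_cast.
have val_m1 : nat_of_ord (- 1 : 'Z_(q j))%R = (q j).-1.
  by rewrite /= !modn_small // -[in RHS](Zp_cast (q_gt1 j)).
by move: ci; rewrite -eqz val_m1 ltnNge -ltnS prednK ?q_lt // ltnW.
Qed.

End Exchange.

Theorem theorem13 (n : nat) (q : 'I_n -> nat) (t k : nat)
    (hq : forall i : 'I_n, 1 < q i) (htk : t < k) (hkn : k <= n) :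
  ~ (forall i j : 'I_n, q i = q j) ->
  ~ (exists P : {set {set word q}}, large_set t k P).
Proof.
move=> neq_q [P lsP]; apply: neq_q.
have t_gt0 := large_set_pos hkn lsP.
suff ge_q i j : q j <= q i by move=> i j; apply/eqP; rewrite eqn_leq !ge_q.
rewrite leqNgt; apply/negP => q_lt.
have neq_ij : i != j by apply: contraTneq q_lt => ->; rewrite ltnn.
(* [0 < t < k] gives [2 <= k], so the subtraction is exact, and [t.-1 <= k - 2] leaves room for [U]
   in [K]. *)
have [K sK cK] : exists2 K : {set 'I_n}, K \subset ~: [set i; j] & #|K| = k - 2.
  apply: subset_of_card.
  by rewrite cardsCs setCK card_ord cards2 neq_ij leq_sub2r.
have [U sU cU] : exists2 U : {set 'I_n}, U \subset K & #|U| = t.-1.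
  by apply: subset_of_card; rewrite cK leq_subRL ?(leq_ltn_trans t_gt0) // add2n prednK.
have cardU l : l \in [set i; j] -> #|l |: U| = t.
  move=> lij; rewrite cardsU1 cU (_ : l \notin U) ?add1n ?prednK //.
  apply: contraL lij => lU.
  by have := subsetP sK _ (subsetP sU _ lU); rewrite inE.
(* Both words have weight [t], so both counts equal [#|P|] and the strict inequality is absurd. *)
have := card_cover_exchange hq q_lt sU sK (k := k).
rewrite !cardU ?set21 ?set22 // !(card_cover_words lsP) ?weight_ones;
  rewrite ?cardU ?set21 ?set22 // ltnn => absurd.
suff /absurd : #|K|.+2 = k by [].
by rewrite cK -addn2 subnK // (leq_ltn_trans t_gt0 htk).
Qed.
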